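(* Let $V:\mathbb{T}^1\to\mathbb{R}$ be a smooth non-constant $\frac12$-periodic function, where $\mathbb{T}^1=\mathbb{R}/\mathbb{Z}$. For $c\in\mathbb{R}$ let $H_c(x,p)=\frac12(p+c)^2+V(x)$ on $\mathbb{T}^1\times\mathbb{R}$, and let $c_{1/2}$ be the cohomology class with rotation number $\frac12$. Then, for the Hamiltonian $H_{c_{1/2}}$, the weak KAM solution $u_1^{c_{1/2}}$ selected by the discrete discounted approximation and the weak KAM solution $U_0^{c_{1/2}}$ selected by the classical discounted approximation satisfy $u_1^{c_{1/2}}\neq U_0^{c_{1/2}}$.
   Context: For $a>\max V$ put $f_a^+(x)=\sqrt{2(a-V(x))}$. The class with rotation number $\frac12$ is $c_{1/2}=\int_0^1 f_a^+(x)\,dx$, where $a>\max V$ is the unique number such that $\int_0^1\frac{ds}{\sqrt{2(a-V(s))}}=2$; equivalently, the time-$1$ Hamiltonian flow of $H_{c_{1/2}}$ restricted to the invariant graph $\{(x,f_a^+(x)-c_{1/2})\}$ and projected to $\mathbb{T}^1$ is a circle diffeomorphism of rotation number $\frac12$ (for the lift obtained by following the flow from time $0$ to time $1$). For $c\in\mathbb{R}$, the Lagrangian is $L_c(x,v)=\sup_p(pv-H_c(x,p))=\frac12v^2-cv-V(x)$, and $h_1^c(y,x)=\inf\int_{-1}^0L_c(\gamma,\dot\gamma)\,ds$ over absolutely continuous curves $\gamma:[-1,0]\to\mathbb{T}^1$ with $\gamma(-1)=y$, $\gamma(0)=x$. Let $\alpha(c)$ be the unique constant for which $H_c(x,u'(x))=\alpha(c)$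 has a viscosity solution on $\mathbb{T}^1$; it is also the unique constant for which $u(x)=\inf_y\big(u(y)+h_1^c(y,x)\big)+\alpha(c)$ has a solution. Discrete selection: for $\lambda\in(0,1)$ let $u_\lambda$ be the unique bounded function with $u_\lambda(x)=\inf_{y\in\mathbb{T}^1}\big(\lambda u_\lambda(y)+h_1^c(y,x)\big)$ for all $x$. Then $u_\lambda+\frac{\alpha(c)}{1-\lambda}$ converges uniformly as $\lambda\to1$, and $u_1^c$ denotes the limit. Classical selection: for $\ell>0$ let $U_\ell$ be the unique viscosity solution of $\ell U_\ell(x)+H_c(x,U_\ell'(x))=0$ on $\mathbb{T}^1$. Then $U_\ell+\frac{\alpha(c)}{\ell}$ converges uniformly as $\ell\to0$, and $U_0^c$ denotes the limit. *)

(* Defs.v *)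
(* The circle T^1 is R/Z: a function on T^1 is a 1-periodic function on R, and
   an absolutely continuous curve on T^1 is represented by an absolutely
   continuous lift to R. *)
From HB Require Import structures.
From mathcomp Require Import all_boot all_order all_algebra.
From mathcomp Require Import all_classical all_reals all_analysis.
From mathcomp Require Import ring lra.

Set Implicit Arguments.
Unset Strict Implicit.
Unset Printing Implicit Defensive.

Import Order.TTheory GRing.Theory Num.Theory.
Import numFieldNormedType.Exports.

Local Open Scope classical_set_scope.
Local Open Scope ring_scope.

Definition smooth (R : realType) (f : R -> R) : Prop :=
  forall (n : nat) (x : R), derivable (derive1n n f) x 1.

Definition C1 (R : realType) (f : R -> R) : Prop :=
  (forall x, derivable f x 1) /\ continuous (derive1 f).

Definition absolutely_continuous (R : realType) (a b : R) (f : R -> R) : Prop :=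
  forall e : R, 0 < e -> exists2 d : R, 0 < d &
    forall (n : nat) (s t : nat -> R),
      (forall i, (i < n)%N -> a <= s i /\ s i <= t i /\ t i <= b) ->
      trivIset `I_n (fun i => `]s i, t i[%classic) ->
      \sum_(i < n) (t i - s i) < d ->
      \sum_(i < n) `|f (t i) - f (s i)| < e.

Definition Hamiltonian (R : realType) (V : R -> R) (c x p : R) : R :=
  2^-1 * (p + c) ^+ 2 + V x.

Definition Lagrangian (R : realType) (V : R -> R) (c x v : R) : R :=
  sup [set p * v - Hamiltonian V c x p | p in [set: R]].

Lemma LagrangianE (R : realType) (V : R -> R) (c x v : R) :
  Lagrangian V c x v = 2^-1 * v ^+ 2 - c * v - V x.
Proof.
set S := [set p * v - Hamiltonian V c x p | p in [set: R]].
have Sv : S (2^-1 * v ^+ 2 - c * v - V x).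
  by exists (v - c) => //; rewrite /Hamiltonian; field.
have ubS : ubound S (2^-1 * v ^+ 2 - c * v - V x).
  move=> _ [p _ <-]; rewrite /Hamiltonian -subr_ge0.
  have -> : 2^-1 * v ^+ 2 - c * v - V x
      - (p * v - (2^-1 * (p + c) ^+ 2 + V x)) = 2^-1 * (p + c - v) ^+ 2.
    by field.
  by rewrite mulr_ge0 ?sqr_ge0// invr_ge0 ler0n.
apply/eqP; rewrite eq_le; apply/andP; split.
  by apply: ge_sup => //; eexists; exact: Sv.
by apply: ub_le_sup => //; eexists; exact: ubS.
Qed.

(* The integrand is bounded below along a continuous curve, so the action is
   well defined in ]-oo, +oo]; the derivative of an absolutely continuous curve
   exists almost everywhere on [-1, 0]. *)
Definition action (R : realType) (V : R -> R) (c : R) (g : R -> R) : \bar R :=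
  (\int[@lebesgue_measure R]_(s in `[(-1)%R, 0%R])
     (Lagrangian V c (g s) (derive1 g s))%:E)%E.

Definition torus_curve (R : realType) (y x : R) (g : R -> R) : Prop :=
  [/\ absolutely_continuous (-1) 0 g,
      g (-1) - y \is a Num.int & g 0 - x \is a Num.int].

Definition h1 (R : realType) (V : R -> R) (c y x : R) : \bar R :=
  ereal_inf [set action V c g | g in [set g | torus_curve y x g]].

(* Viscosity solutions on T^1 of F (x, u x, u' x) = 0. *)
Definition viscosity_subsolution (R : realType) (F : R -> R -> R -> R)
    (u : R -> R) : Prop :=
  forall (phi : R -> R) (x : R), C1 phi ->
    (\forall y \near x, u y - phi y <= u x - phi x) ->
    F x (u x) (derive1 phi x) <= 0.

Definition viscosity_supersolution (R : realType) (F : R -> R -> R -> R)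
    (u : R -> R) : Prop :=
  forall (phi : R -> R) (x : R), C1 phi ->
    (\forall y \near x, u x - phi x <= u y - phi y) ->
    0 <= F x (u x) (derive1 phi x).

Definition viscosity_solution (R : realType) (F : R -> R -> R -> R)
    (u : R -> R) : Prop :=
  [/\ periodic u 1, continuous u,
      viscosity_subsolution F u & viscosity_supersolution F u].

Definition critical_value (R : realType) (V : R -> R) (c alpha : R) : Prop :=
  exists u : R -> R,
    viscosity_solution (fun x _ p => Hamiltonian V c x p - alpha) u.

(* The speed on the graph p = f_a^+ (x) - c is f_a^+ (x) = sqrt (2 (a - V x));
   rotation number 1/2 means that one turn around the circle takes time 2. *)
Definition half_rotation_class (R : realType) (V : R -> R) (c : R) : Prop :=
  exists a : R,
    [/\ forall x, V x < a,
        \int[@lebesgue_measure R]_(s in `[(0 : R), 1])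
          (Num.sqrt (2 * (a - V s)))^-1 = 2 &
        c = \int[@lebesgue_measure R]_(x in `[(0 : R), 1])
          Num.sqrt (2 * (a - V x))].

Definition discrete_discounted_solution (R : realType) (V : R -> R)
    (c lambda : R) (u : R -> R) : Prop :=
  [/\ periodic u 1,
      exists M : R, forall x, `|u x| <= M &
      forall x, (u x)%:E =
        ereal_inf [set ((lambda * u y)%R%:E + h1 V c y x)%E | y in [set: R]]].

Definition classical_discounted_solution (R : realType) (V : R -> R)
    (c l : R) (U : R -> R) : Prop :=
  viscosity_solution (fun x r p => l * r + Hamiltonian V c x p) U.

Definition discrete_selection (R : realType) (V : R -> R) (c alpha : R)
    (u1 : R -> R) : Prop :=
  exists u : R -> R -> R,
    (forall lambda : R, 0 < lambda < 1 ->
       discrete_discounted_solution V c lambda (u lambda)) /\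
    {uniform, (fun lambda x => u lambda x + alpha / (1 - lambda)) @ 1^'-
       --> u1}.

Definition classical_selection (R : realType) (V : R -> R) (c alpha : R)
    (U0 : R -> R) : Prop :=
  exists U : R -> R -> R,
    (forall l : R, 0 < l -> classical_discounted_solution V c l (U l)) /\
    {uniform, (fun l x => U l x + alpha / l) @ 0^'+ --> U0}.

(* Main.v *)
Require Import Defs.
From HB Require Import structures.
From mathcomp Require Import all_boot all_order all_algebra.
From mathcomp Require Import all_classical all_reals all_analysis.
From mathcomp Require Import ring lra.
Import Order.TTheory GRing.Theory Num.Theory.
Import numFieldNormedType.Exports.
Local Open Scope classical_set_scope.
Local Open Scope ring_scope.

Set Implicit Arguments.
Unset Strict Implicit.

(** Let [f x = sqrt (2 (a - V x))], let [F' = f] and [u x = F x - c x]. Since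
    [c] is the mean of [f], [u] is a smooth 1-periodic solution of
    [H_c (x, u') = a]; comparing it with any viscosity solution at points where
    the difference is extremal gives [alpha = a]
    ([critical_value_smooth]). Everything is 1/2-periodic, and [tau' = 1/f]
    measures time along the flow [g' = f g]. As a full turn takes time 2, the
    time-1 map of this flow is the translation by 1/2, so every point of the
    circle is 2-periodic for it. Both selections have the form [u + constant],
    but the two constants differ.

    Discrete side. The orbit from [x - 1/2] to [x] is calibrated by [u], and
    [u (x - 1/2) = u x], so its action is [- a] ([h1_along_flow]). Going twice
    around this 2-cycle in the fixed point equation bounds [u_lambda x] by
    [- a / (1 - lambda)] at every [x], hence [u1 <= 0] everywhere
    ([discrete_selection_le]).

    Classical side. Here the constant is normalised by the invariant measure with
    density proportional to [1/f], of full support. Let [k] be such that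
    [(u + k) / f] has integral zero over a period, and let [w] be the periodic
    function with [f w' = - (u + k)]. Then, for a suitable constant [C],
    [u + k - a / l + l w - l C] is a smooth subsolution of the discounted
    equation. It lies below [U_l], whence [u + k <= U0] in the limit
    ([classical_selection_ge]).

    If [u1 = U0], then [u + k <= 0], so [w' >= 0]. A nondecreasing periodic
    function is constant, so [u = - k] is constant, [f = u' + c] is constant
    and so is [V], against the hypothesis. All comparisons are made with C1
    functions, for which the definition of viscosity solution suffices. *)

(** * Primitives, periodic functions and autonomous flows *)

Section calculus.
Variable R : realType.
Implicit Types (f g dg G : R -> R).

Lemma primitive_continuous G g :
  (forall x : R, is_derive x 1 G (g x)) -> continuous G.
Proof.
move=> dG x; apply: differentiable_continuous; apply/derivable1_diffP.
by have [] := dG x.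
Qed.

Lemma continuous_integrable_itv g (a b : R) : continuous g ->
  lebesgue_measure.-integrable `[a, b] (EFin \o g).
Proof.
move=> cg; apply: continuous_compact_integrable; first exact: segment_compact.
exact: continuous_subspaceT.
Qed.

Lemma exists_primitive g : continuous g ->
  exists G, forall x : R, is_derive x 1 G (g x).
Proof.
move=> cg.
pose G (x : R) := if 0 <= x then \int[lebesgue_measure]_(t in `]0, x]) g t
  else - \int[lebesgue_measure]_(t in `]x, 0]) g t.
exists G => x.
(* A base point left of both 0 and [x], so that a neighbourhood of [x] is
   treated by the fundamental theorem on a half-line whatever the sign of
   [x]. *)
pose a : R := - (`|x| + 1).
have ax : a < x.
  by rewrite /a; have := ler_norm (- x); rewrite normrN; lra.
have a0 : a < 0 by rewrite /a; have := normr_ge0 x; lra.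
pose F := fun x0 : R => \int[lebesgue_measure]_(t in `[a, x0]) g t.
have [dF F'] : derivable F x 1 /\ F^`()%classic x = g x.
  apply: (@continuous_FTC1_closed _ _ _ _ (x + 1)) => //; first by lra.
    exact: continuous_integrable_itv.
  exact: cg.
have dFx : is_derive x 1 F (g x).
  by rewrite derive1E in F'; exact: DeriveDef.
apply: (@near_eq_is_derive _ _ _ (fun t => F t - F 0)).
- near=> t.
  have at_ : a < t by near: t; exact: lt_nbhsr.
  rewrite /G /F; case: ifPn => t0.
    rewrite (@Rintegral_itvB _ _ (BLeft a) (BRight t) 0) //=.
    - exact: continuous_integrable_itv.
    - by rewrite bnd_simp ltW.
  rewrite -ltNge in t0.
  rewrite -(@Rintegral_itvB _ _ (BLeft a) (BRight 0) t) ?opprB//=.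
  - exact: continuous_integrable_itv.
  - by rewrite bnd_simp ltW.
  - by rewrite bnd_simp ltW.
- by apply: is_derive_eq; rewrite subr0.
Unshelve. all: by end_near. Qed.

Lemma primitive_shift G g p : (forall x : R, is_derive x 1 G (g x)) ->
  periodic g p -> forall x, G (x + p) = G x + (G p - G 0).
Proof.
move=> dG pg x.
suff : G (x + p) - G x = G (0 + p) - G 0 by rewrite add0r; lra.
apply: (@is_derive_0_is_cst _ (fun x => G (x + p) - G x)) => y.
have h : is_derive y 1 (fun x => G (x + p)) (g y).
  have := dG (y + p); rewrite pg => h.
  have h1 : is_derive y 1 (fun x : R => x + p) 1.
    by apply: is_derive_eq; rewrite addr0.
  by have := @is_derive1_comp _ G (fun x : R => x + p) y _ _ h h1; rewrite mulr1.
by apply: is_derive_eq; rewrite subrr.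
Qed.

Lemma integral_primitive G g (a b : R) : a < b -> continuous g ->
  (forall x : R, is_derive x 1 G (g x)) ->
  (\int[lebesgue_measure]_(x in `[a, b]) (g x)%:E = (G b - G a)%:E)%E.
Proof.
move=> ab cg dG.
rewrite (@continuous_FTC2 _ g G a b) ?EFinB//.
- exact: continuous_subspaceT.
- have cG := primitive_continuous dG.
  split; first by move=> x _; have [] := dG x.
    exact: cvg_at_right_filter (cG a).
  exact: cvg_at_left_filter (cG b).
- by move=> x _; rewrite derive1E; have [] := dG x.
Qed.

Lemma Rintegral_primitive G g (a b : R) : a < b -> continuous g ->
  (forall x : R, is_derive x 1 G (g x)) ->
  \int[lebesgue_measure]_(x in `[a, b]) g x = G b - G a.
Proof. by move=> *; rewrite /Rintegral (@integral_primitive G). Qed.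

Lemma periodic_int g (n : int) : periodic g 1 -> forall x, g (x + n%:~R) = g x.
Proof.
move=> pg x; case: n => n; first exact: (periodicn pg).
by rewrite NegzE -[in RHS](subrK n.+1%:R x) (periodicn pg n.+1) rmorphN.
Qed.

Lemma periodic_argmin g : continuous g -> periodic g 1 ->
  exists x0, forall x, g x0 <= g x.
Proof.
move=> cg pg.
have [x0 _ gx0] : exists2 c, c \in `[0, 1] & forall t, t \in `[0, 1] -> g c <= g t.
  by apply: EVT_min => //; exact: continuous_subspaceT.
exists x0 => x.
rewrite -[x](subrK (Num.floor x)%:~R) (periodic_int _ pg).
apply: gx0; rewrite in_itv /=.
by have := Num.Theory.floor_itv x; lra.
Qed.

Lemma periodic_argmax g : continuous g -> periodic g 1 ->
  exists x0, forall x, g x <= g x0.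
Proof.
move=> cg pg.
have [x0 h] : exists x0, forall x, - g x0 <= - g x.
  apply: (@periodic_argmin (fun x => - g x)).
    by move=> x; apply: cvgN; exact: cg.
  by move=> x; rewrite pg.
by exists x0 => x; rewrite -lerN2.
Qed.

Lemma primitive_MVT G g (x y : R) : (forall x : R, is_derive x 1 G (g x)) ->
  x <= y -> exists2 z : R, x <= z <= y & G y - G x = g z * (y - x).
Proof.
move=> dG xy.
have [|z] := @MVT_segment R G g x y xy (fun z _ => dG z).
  by apply: continuous_subspaceT; exact: primitive_continuous dG.
by rewrite in_itv /=; exists z.
Qed.

Lemma primitive_lt G g : (forall x : R, is_derive x 1 G (g x)) ->
  (forall x, 0 < g x) -> {homo G : x y / x < y}.
Proof.
move=> dG g0 x y xy; have [z _ e] := primitive_MVT dG (ltW xy).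
by rewrite -subr_gt0 e mulr_gt0 // subr_gt0.
Qed.

Lemma primitive_le G g : (forall x : R, is_derive x 1 G (g x)) ->
  (forall x, 0 <= g x) -> {homo G : x y / x <= y}.
Proof.
move=> dG g0 x y xy; have [z _ e] := primitive_MVT dG xy.
by rewrite -subr_ge0 e mulr_ge0 // subr_ge0.
Qed.

(** Each period adds the same positive amount to [G], so [G] is unbounded in
    both directions. *)
Lemma primitive_surjective G g : (forall x : R, is_derive x 1 G (g x)) ->
  (forall x, 0 < g x) -> periodic g 1 -> forall v, exists x, G x = v.
Proof.
move=> dG g0 pg v.
have D0 : 0 < G 1 - G 0.
  by rewrite subr_gt0; apply: (primitive_lt dG g0).
pose D := G 1 - G 0.
have Gn (n : nat) x : G (x + n%:R) = G x + D * n%:R.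
  elim: n => [|n IH]; first by rewrite mulr0 !addr0.
  by rewrite -natr1 addrA (primitive_shift dG pg) IH -/D; ring.
pose n := (Num.truncn (`|v - G 0| / D)).+1.
have hn : `|v - G 0| < D * n%:R.
  by rewrite mulrC -ltr_pdivrMr //; exact: truncnS_gt.
have n0 : (0 : R) <= n%:R by exact: ler0n.
have [|||x _ <-] := @IVT R G (- n%:R) n%:R v; last by exists x.
- lra.
- by apply: continuous_subspaceT; exact: primitive_continuous dG.
have e1 := Gn n 0; have e2 := Gn n (- n%:R).
rewrite addNr in e2; rewrite add0r in e1.
move: hn; rewrite ltr_norml => /andP[h1 h2].
by rewrite ge_min le_max; apply/andP; split; apply/orP; [left|right]; lra.
Qed.

(** Separation of variables: if [G' = 1 / f], then [G] is the time along the
    solutions of [K' = f K], and its inverse is such a solution. *)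
Lemma autonomous_flow f G : continuous f -> (forall x, 0 < f x) ->
  periodic f 1 -> (forall x : R, is_derive x 1 G (f x)^-1) ->
  exists K, [/\ cancel G K, cancel K G &
                forall t : R, is_derive t 1 K (f (K t))].
Proof.
move=> cf f0 pf dG.
have fV0 x : 0 < (f x)^-1 by rewrite invr_gt0.
have pfV : periodic (fun x => (f x)^-1) 1 by move=> x; rewrite pf.
have [K KG] := choice (primitive_surjective dG fV0 pfV).
have GK : cancel G K.
  move=> x; have := KG (G x); set y := K _ => e.
  by case: (ltgtP y x) => // /(primitive_lt dG fV0); rewrite e ltxx.
exists K; split=> // t.
rewrite -{1}(KG t) -[f _]invrK.
apply: (@is_derive_inverse R G K).
- by near=> z; exact: GK.
- by near=> z; exact: (primitive_continuous dG).
- by rewrite gt_eqF.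
Unshelve. all: by end_near. Qed.

(** Such a function is Lipschitz on the compact interval. *)
Lemma C1_absolutely_continuous (a b : R) g dg : a <= b ->
  (forall x : R, is_derive x 1 g (dg x)) -> continuous dg ->
  absolutely_continuous a b g.
Proof.
move=> ab dG cdg e e0.
have [m _ hm] : exists2 m, m \in `[a, b] &
    forall t, t \in `[a, b] -> `|dg t| <= `|dg m|.
  apply: (@EVT_max R (fun t => `|dg t|)) => //.
  apply: continuous_subspaceT => x.
  by apply: (@continuous_comp _ _ _ dg); [exact: cdg|exact: norm_continuous].
have M0 : 0 < `|dg m| + 1 by rewrite ltr_wpDl.
exists (e / (`|dg m| + 1)); first by rewrite divr_gt0.
move=> n s t st _ sum_lt.
apply: (@le_lt_trans _ _ (\sum_(i < n) (`|dg m| + 1) * (t i - s i))).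
  apply: ler_sum => i _; have [as_ [st_ tb]] := st i (ltn_ord i).
  have [z /andP[sz zt] ->] := primitive_MVT dG st_.
  rewrite normrM [X in _ * X]ger0_norm ?subr_ge0//.
  apply: ler_wpM2r; first by rewrite subr_ge0.
  apply: (@le_trans _ _ `|dg m|); last by rewrite lerDl.
  apply: hm; rewrite in_itv /=; apply/andP; split; lra.
by rewrite -mulr_sumr mulrC -ltr_pdivlMr.
Qed.

Lemma periodic_nondecreasing_cst g : periodic g 1 ->
  {homo g : x y / x <= y} -> forall x y, g x = g y.
Proof.
move=> pg hg.
suff h x y : g x <= g y by move=> x y; apply/eqP; rewrite eq_le !h.
pose n := (Num.truncn `|x - y|).+1.
rewrite -(periodicn pg n y); apply: hg.
have := truncnS_gt `|x - y|; rewrite -/n => h.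
have := ler_norm (x - y).
by rewrite -[1 *+ n]/(n%:R); lra.
Qed.

(** The increment over a half-period does not depend on where it starts, so it
    is half the increment over [[0, 1]]. *)
Lemma primitive_half_shift G g : continuous g -> periodic g 2^-1 ->
  (forall x : R, is_derive x 1 G (g x)) ->
  forall x, G (x + 2^-1) =
    G x + 2^-1 * \int[lebesgue_measure]_(t in `[0, 1]) g t.
Proof.
move=> cg pg dG x.
rewrite (Rintegral_primitive _ cg dG); last by lra.
have e1 := primitive_shift dG pg 2^-1.
have e2 : 2^-1 + 2^-1 = 1 :> R by lra.
rewrite e2 in e1.
by rewrite (primitive_shift dG pg x); lra.
Qed.

Lemma half_periodic1 g : periodic g 2^-1 -> periodic g 1.
Proof.
move=> pg x; have -> : x + 1 = x + 2^-1 + 2^-1 by lra.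
by rewrite !pg.
Qed.

Lemma primitive_derive1 G g : (forall x : R, is_derive x 1 G (g x)) ->
  derive1 G = g.
Proof. by move=> dG; apply/funext => x; rewrite derive1E; have [] := dG x. Qed.

Lemma uniform_cvg_at (F : set_system R) {FF : Filter F} (u : R -> R -> R)
    (v : R -> R) x :
  {uniform, u @ F --> v} -> (fun t => u t x) @ F --> v x.
Proof.
by move=> uv; have /pointwise_cvgP/(_ x) := [elaborate pointwise_uniform_cvg _ uv].
Qed.

End calculus.

(** * Comparison of viscosity solutions with smooth functions *)

Section weakKAM.
Variable R : realType.
Implicit Types (f g F G U V u v w du dv dw : R -> R).

Lemma primitive_C1 G g : (forall x : R, is_derive x 1 G (g x)) ->
  continuous g -> C1 G.
Proof.
move=> dG cg; split; first by move=> x; have [] := dG x.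
by rewrite (primitive_derive1 dG).
Qed.

(** The test function [v] touches [U] from below, up to a constant, at a point
    where the periodic function [U - v] is minimal. *)
Lemma smooth_below_supersolution (H : R -> R -> R -> R) U v dv :
  continuous U -> periodic U 1 -> viscosity_supersolution H U ->
  (forall x : R, is_derive x 1 v (dv x)) -> continuous dv -> periodic v 1 ->
  exists2 x, 0 <= H x (U x) (dv x) & forall y, v y + (U x - v x) <= U y.
Proof.
move=> cU pU sU dv_ cdv pv.
have [||x0 hx] := @periodic_argmin R (fun x => U x - v x) _ _.
- by move=> x; apply: cvgB; [exact: cU|exact: (primitive_continuous dv_)].
- by move=> x; rewrite pU pv.
exists x0; last by move=> y; have := hx y; lra.
rewrite -(primitive_derive1 dv_); apply: sU; first exact: primitive_C1 cdv.
by apply: filterE => y; exact: hx.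
Qed.

Lemma smooth_above_subsolution (H : R -> R -> R -> R) U v dv :
  continuous U -> periodic U 1 -> viscosity_subsolution H U ->
  (forall x : R, is_derive x 1 v (dv x)) -> continuous dv -> periodic v 1 ->
  exists x, H x (U x) (dv x) <= 0.
Proof.
move=> cU pU sU dv_ cdv pv.
have [||x0 hx] := @periodic_argmax R (fun x => U x - v x) _ _.
- by move=> x; apply: cvgB; [exact: cU|exact: (primitive_continuous dv_)].
- by move=> x; rewrite pU pv.
exists x0.
rewrite -(primitive_derive1 dv_); apply: sU; first exact: primitive_C1 cdv.
by apply: filterE => y; exact: hx.
Qed.

Lemma critical_value_smooth V c a alpha u du :
  critical_value V c alpha ->
  (forall x : R, is_derive x 1 u (du x)) -> continuous du -> periodic u 1 ->
  (forall x, Hamiltonian V c x (du x) = a) -> alpha = a.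
Proof.
move=> [w [pw cw sub_w super_w]] du_ cdu pu eik.
have [x] := smooth_above_subsolution cw pw sub_w du_ cdu pu.
have [y] := smooth_below_supersolution cw pw super_w du_ cdu pu.
by rewrite !eik; lra.
Qed.

(** Comparison principle. At a minimum point [y] of [U - v], the equation gives
    [l * U y >= - Hamiltonian V c y (dv y) >= l * v y], so the minimum is
    nonnegative. *)
Lemma classical_discounted_ge V c l U v dv :
  0 < l -> classical_discounted_solution V c l U ->
  (forall x : R, is_derive x 1 v (dv x)) -> continuous dv -> periodic v 1 ->
  (forall x, l * v x + Hamiltonian V c x (dv x) <= 0) ->
  forall x, v x <= U x.
Proof.
move=> l0 [pU cU _ superU] dv_ cdv pv sub x.
have [y + h] := smooth_below_supersolution cU pU superU dv_ cdv pv.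
move: (sub y) (h x) => s1 s2 s3.
suff : v y <= U y by lra.
by rewrite -(ler_pM2l l0); lra.
Qed.

(** * The action along the flow and the discrete selection *)

(** By the Legendre equality along [g' = f g], the Lagrangian is
    [(f g - c) g' - a], the derivative of [F g - c g - a s]. *)
Lemma calibrated_action V c a f F g :
  (forall x, Hamiltonian V c x (f x - c) = a) -> continuous f ->
  (forall x : R, is_derive x 1 F (f x)) ->
  (forall s : R, is_derive s 1 g (f (g s))) ->
  action V c g = ((F (g 0) - c * g 0) - (F (g (-1)) - c * g (-1)) - a)%:E.
Proof.
move=> eik cf dF dg.
rewrite /action (primitive_derive1 dg).
pose S s := F (g s) - c * g s - a * s.
pose dS s := f (g s) ^+ 2 - c * f (g s) - a.
have dSS (s : R) : is_derive s 1 S (dS s).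
  have h := @is_derive1_comp _ F g s _ _ (dF (g s)) (dg s).
  have h1 : is_derive s 1 (fun s => F (g s)) (f (g s) * f (g s)) by exact: h.
  rewrite /S /dS; apply: is_derive_eq.
  by rewrite /GRing.scale /= mulr1 expr2.
have cS : continuous dS.
  have cfg : continuous (fun s => f (g s)).
    move=> s; apply: (@continuous_comp _ _ _ g f); last exact: cf.
    exact: (primitive_continuous dg).
  move=> s; apply: cvgB; last exact: cvg_cst.
  apply: cvgB; last by apply: cvgM; [exact: cvg_cst|exact: cfg].
  by apply: cvgM; exact: cfg.
under eq_integral => s _.
  rewrite LagrangianE.
  have -> : 2^-1 * f (g s) ^+ 2 - c * f (g s) - V (g s) = dS s.
    by have := eik (g s); rewrite /Hamiltonian subrK /dS; lra.
  over.
rewrite (integral_primitive _ cS dSS); last by lra.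
by congr (_%:E); rewrite /S; lra.
Qed.

(** [G] is the time along the flow, so the orbit starting at [y] reaches [x]
    after time 1; its action bounds the minimal one. *)
Lemma h1_along_flow V c a f F G :
  (forall x, Hamiltonian V c x (f x - c) = a) -> continuous f ->
  (forall x, 0 < f x) -> periodic f 1 ->
  (forall x : R, is_derive x 1 F (f x)) ->
  (forall x : R, is_derive x 1 G (f x)^-1) ->
  forall x y, G x = G y + 1 ->
  (h1 V c y x <= ((F x - c * x) - (F y - c * y) - a)%:E)%E.
Proof.
move=> eik cf f0 pf dF dG x y xy.
have [K [GK KG dK]] := autonomous_flow cf f0 pf dG.
pose g s := K (s + G x).
have dg (s : R) : is_derive s 1 g (f (g s)).
  have h1 : is_derive s 1 (fun s : R => s + G x) 1.
    by apply: is_derive_eq; rewrite addr0.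
  have := @is_derive1_comp _ K (fun s : R => s + G x) s _ _ (dK _) h1.
  by rewrite mulr1.
have g0 : g 0 = x by rewrite /g add0r.
have g1 : g (-1) = y by rewrite /g xy addrC addrK.
apply: ereal_inf_lbound; exists g; last first.
  by rewrite (calibrated_action eik cf dF dg) g0 g1.
split; rewrite ?g0 ?g1 ?subrr //.
apply: (C1_absolutely_continuous _ dg); first by lra.
move=> s; apply: (@continuous_comp _ _ _ g f); last exact: cf.
exact: (primitive_continuous dg).
Qed.

Lemma discrete_discounted_le V c lambda u x y b :
  discrete_discounted_solution V c lambda u -> (h1 V c y x <= b%:E)%E ->
  u x <= lambda * u y + b.
Proof.
move=> [_ _ eq_u] hb.
rewrite -lee_fin eq_u; apply: (@le_trans _ _ ((lambda * u y)%:E + h1 V c y x)%E).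
  by apply: ereal_inf_lbound; exists y.
by rewrite EFinD leeD2l.
Qed.

(** Two steps give [u x <= lambda ^ 2 * u x - (1 + lambda) * a]; dividing by
    [1 - lambda ^ 2] gives the bound. *)
Lemma discrete_discounted_2cycle V c a lambda u x y z :
  0 < lambda < 1 -> discrete_discounted_solution V c lambda u ->
  u z = u x -> (h1 V c y x <= (- a)%:E)%E -> (h1 V c z y <= (- a)%:E)%E ->
  u x + a / (1 - lambda) <= 0.
Proof.
move=> /andP[l0 l1] du zx hyx hzy.
have e1 := discrete_discounted_le du hyx.
have e2 := discrete_discounted_le du hzy.
rewrite zx in e2.
have e3 : lambda * u y <= lambda * (lambda * u x - a) by rewrite ler_pM2l.
have l10 : 0 < 1 - lambda by lra.
rewrite -(ler_pM2l l10) mulr0 mulrDr mulrCA divff ?mulr1 ?gt_eqF//.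
have l11 : 0 < 1 + lambda by lra.
by rewrite -(ler_pM2l l11) mulr0; lra.
Qed.

Lemma discrete_selection_le V c a u1 x y :
  (h1 V c y x <= (- a)%:E)%E -> (h1 V c (x - 1) y <= (- a)%:E)%E ->
  discrete_selection V c a u1 -> u1 x <= 0.
Proof.
move=> hyx hzy [u [solu cvgu]].
have cvgux : u l x + a / (1 - l) @[l --> 1^'-] --> u1 x.
  exact: (uniform_cvg_at (x := x) cvgu).
apply: (ler_cvg_to cvgux (cvg_cst _)).
near=> l.
have l01 : 0 < l < 1.
  by apply/andP; split; near: l; [exact: nbhs_left_gt|exact: nbhs_left_lt].
apply: (discrete_discounted_2cycle l01 (solu l l01) _ hyx hzy).
by have [pu _ _] := solu l l01; rewrite -[in RHS](subrK 1 x) pu.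
Unshelve. all: by end_near. Qed.

(** * The classical selection *)

(** First-order perturbation of the critical solution: in the discounted
    equation for [u + k - a / l + l * w - l * C] the terms of order [l] cancel by
    the choice of [dw], and [C] makes the terms of order [l ^ 2] nonpositive. *)
Lemma classical_selection_ge V c a f u w dw (k : R) U0 :
  (forall x, Hamiltonian V c x (f x - c) = a) -> continuous f ->
  (forall x : R, is_derive x 1 u (f x - c)) -> periodic u 1 ->
  (forall x : R, is_derive x 1 w (dw x)) -> continuous dw ->
  periodic w 1 -> periodic dw 1 ->
  (forall x, f x * dw x = - (u x + k)) ->
  classical_selection V c a U0 -> forall x, u x + k <= U0 x.
Proof.
move=> eik cf du pu dw_ cdw pw pdw corr [U [solU cvgU]] x.
have [||m hm] := @periodic_argmax R (fun x => w x + 2^-1 * dw x ^+ 2).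
- move=> y; apply: cvgD; first exact: (primitive_continuous dw_).
  by apply: cvgM; [exact: cvg_cst|apply: cvgM; exact: cdw].
- by move=> y; rewrite pw pdw.
pose C := w m + 2^-1 * dw m ^+ 2.
have lower l : 0 < l -> u x + k + l * (w x - C) <= U l x + a / l.
  move=> l0.
  pose v y := u y + l * w y + (k - a / l - l * C).
  have dv (y : R) : is_derive y 1 v (f y - c + l * dw y).
    by rewrite /v; apply: is_derive_eq; rewrite addr0.
  have cv : continuous (fun y => f y - c + l * dw y).
    move=> y; apply: cvgD; first by apply: cvgB; [exact: cf|exact: cvg_cst].
    by apply: cvgM; [exact: cvg_cst|exact: cdw].
  have pv : periodic v 1 by move=> y; rewrite /v pu pw.
  have sub y : l * v y + Hamiltonian V c y (f y - c + l * dw y) <= 0.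
    (* Expansion in powers of [l]; the last summand vanishes by [eik]. *)
    have -> : l * v y + Hamiltonian V c y (f y - c + l * dw y) =
        l * (u y + k + f y * dw y) +
        l ^+ 2 * (w y + 2^-1 * dw y ^+ 2 - C) +
        (Hamiltonian V c y (f y - c) - a).
      by rewrite /v /Hamiltonian; field; rewrite gt_eqF.
    rewrite eik corr !subrr mulr0 add0r addr0 mulr_ge0_le0 ?sqr_ge0//.
    by rewrite subr_le0 hm.
  have := classical_discounted_ge l0 (solU l l0) dv cv pv sub x.
  by rewrite /v; lra.
have cvgUx : U l x + a / l @[l --> 0^'+] --> U0 x.
  exact: (uniform_cvg_at (x := x) cvgU).
have cvg_lower : u x + k + l * (w x - C) @[l --> 0^'+] --> u x + k.
  rewrite -[X in _ --> X](_ : u x + k + 0 * (w x - C) = _);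
    last by rewrite mul0r addr0.
  apply: cvgD; first exact: cvg_cst.
  apply: cvgM; last exact: cvg_cst.
  exact: cvg_at_right_filter cvg_id.
apply: (ler_cvg_to cvg_lower cvgUx).
near=> l; apply: lower; near: l; exact: nbhs_right_gt.
Unshelve. all: by end_near. Qed.

End weakKAM.

(** * The two selections differ *)

Theorem proposition4p5p5 (R : realType) (V : R -> R)
    (V_smooth : smooth V)
    (V_half_periodic : periodic V 2^-1)
    (V_nonconstant : ~ exists k : R, forall x : R, V x = k)
    (c alpha : R)
    (c_half : half_rotation_class V c)
    (alpha_critical : critical_value V c alpha)
    (u1 U0 : R -> R)
    (u1_selected : discrete_selection V c alpha u1)
    (U0_selected : classical_selection V c alpha U0) :
  u1 <> U0.
Proof.
move=> u1U0; apply: V_nonconstant.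
have [a [Va half_period c_def]] := c_half.
pose f x := Num.sqrt (2 * (a - V x)).
have f0 x : 0 < f x by rewrite sqrtr_gt0 mulr_gt0 // subr_gt0.
have eik x : Hamiltonian V c x (f x - c) = a.
  by rewrite /Hamiltonian subrK sqr_sqrtr; [lra|have := Va x; lra].
have cf : continuous f.
  have cV : continuous V.
    move=> x; apply: differentiable_continuous; apply/derivable1_diffP.
    exact: (V_smooth 0%N).
  move=> x; apply: (@continuous_comp _ _ _ (fun x => 2 * (a - V x))).
    by apply: cvgM; [|apply: cvgB; [|exact: cV]]; exact: cvg_cst.
  exact: sqrt_continuous.
have cfV : continuous (fun x => (f x)^-1).
  by move=> x; apply: cvgV; [rewrite gt_eqF|exact: cf].
have pf2 : periodic f 2^-1 by move=> x; rewrite /f V_half_periodic.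
have pf := half_periodic1 pf2.
have pfV2 : periodic (fun x => (f x)^-1) 2^-1 by move=> x; rewrite pf2.
have [F dF] := exists_primitive cf.
have [tau dtau] := exists_primitive cfV.
have F_half := primitive_half_shift cf pf2 dF.
have tau_half := primitive_half_shift cfV pfV2 dtau.
rewrite -c_def in F_half; rewrite half_period in tau_half.
pose u x := F x - c * x.
have du (x : R) : is_derive x 1 u (f x - c).
  by rewrite /u; apply: is_derive_eq; rewrite /GRing.scale /= mulr1.
have cdu : continuous (fun x => f x - c).
  by move=> x; apply: cvgB; [exact: cf|exact: cvg_cst].
have pu2 : periodic u 2^-1 by move=> x; rewrite /u F_half; lra.
have pu := half_periodic1 pu2.
have alpha_a := critical_value_smooth alpha_critical du cdu pu eik.
rewrite {alpha}alpha_a in alpha_critical u1_selected U0_selected.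
have step x : (h1 V c (x - 2^-1) x <= (- a)%:E)%E.
  apply: le_trans (h1_along_flow eik cf f0 pf dF dtau _) _.
    by rewrite -[in LHS](subrK 2^-1 x) tau_half; lra.
  by rewrite lee_fin -[X in F X - _](subrK 2^-1 x) F_half; lra.
have u1_le0 x : u1 x <= 0.
  apply: (discrete_selection_le (step x) _ u1_selected).
  by have := step (x - 2^-1); congr (h1 V c _ _ <= _)%E; lra.
have cu := primitive_continuous du.
have cuf : continuous (fun x => u x * (f x)^-1).
  by move=> x; apply: cvgM; [exact: cu|exact: cfV].
have [P dP] := exists_primitive cuf.
(* [k] makes the integral of [(u + k) / f] over a period vanish, that is, makes
   its primitive [- w] periodic. *)
pose k := - (P 1 - P 0) / (tau 1 - tau 0).
pose w x := - (P x + k * tau x).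
pose dw x := - (u x * (f x)^-1 + k * (f x)^-1).
have dw_ (x : R) : is_derive x 1 w (dw x).
  by rewrite /w /dw; apply: is_derive_eq.
have cdw : continuous dw.
  move=> x; apply: cvgN; apply: cvgD; first exact: cuf.
  by apply: cvgM; [exact: cvg_cst|exact: cfV].
have pdw : periodic dw 1 by move=> x; rewrite /dw pu pf.
have tau1 : 0 < tau 1 - tau 0.
  rewrite subr_gt0; apply: (primitive_lt dtau) => // x.
  by rewrite invr_gt0.
have pw : periodic w 1.
  move=> x; rewrite (primitive_shift dw_ pdw).
  suff -> : w 1 = w 0 by rewrite subrr addr0.
  by rewrite /w /k; field; rewrite gt_eqF.
have corr x : f x * dw x = - (u x + k).
  by rewrite /dw; field; rewrite gt_eqF.
have U0_ge := classical_selection_ge eik cf du pu dw_ cdw pw pdw corr U0_selected.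
have uk x : u x + k <= 0 by rewrite (le_trans (U0_ge x)) // -u1U0.
have dw0 x : 0 <= dw x.
  by rewrite -(pmulr_rge0 _ (f0 x)) corr oppr_ge0.
have w_cst := periodic_nondecreasing_cst pw (primitive_le dw_ dw0).
have dw_eq0 x : dw x = 0.
  have e : w = cst (w 0) by apply/funext => y; exact: w_cst.
  have [_ <-] := dw_ x; rewrite e; exact: derive_cst.
have u_cst x : u x = - k.
  by have := corr x; rewrite dw_eq0 mulr0; lra.
have f_cst x : f x = c.
  apply/eqP; rewrite -subr_eq0; apply/eqP.
  have e : u = cst (- k) by apply/funext.
  have [_ <-] := du x; rewrite e; exact: derive_cst.
exists (a - 2^-1 * c ^+ 2) => x.
by have := eik x; rewrite /Hamiltonian subrK f_cst; lra.
Qed.
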